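(* Let $n\ge 2$, let $S=\{p_1,\dots,p_n\}$ be a set of $n$ point sites in $\mathbb{R}^d$, and let $\{d_{p_i}\}_{1\le i\le n}$ be an admissible system of distance functions. Let $C\subset\mathbb{R}^d$ be a bounded open set, and let $\lambda_1,\dots,\lambda_n>0$ be real numbers with $\lambda_1+\dots+\lambda_n=\mu(C)$. Then there exists a weight vector $w=(w_1,\dots,w_n)\in\mathbb{R}^n$ such that $\mu\bigl(C\cap \mathrm{VR}_w(p_i,S)\bigr)=\lambda_i$ for all $1\le i\le n$. If, moreover, $C$ is path-connected, then such a $w$ is unique up to adding the same constant to all $w_i$, and consequently the parts $C_i=C\cap\mathrm{VR}_w(p_i,S)$ are uniquely determined.
   Context: $\mu$ is a measure defined on all Lebesgue-measurable subsets of $\mathbb{R}^d$ such that $\mu$ and $d$-dimensional Lebesgue measure are mutually absolutely continuous. Each site $p\in S$ has a continuous function $d_p:\mathbb{R}^d\to\mathbb{R}_{\ge 0}$. For $p\neq q\in S$ and $\gamma\in\mathbb{R}$ let $R_\gamma(p,q)=\{z\in\mathbb{R}^d : d_p(z)-d_q(z)<\gamma\}$. The system $\{d_p\}_{p\in S}$ is called admissible if for all $p\neq q\in S$ and every bounded open set $C\subset\mathbb{R}^d$ there exist real numbers $m_{pq}<M_{pq}$ such that the function $\gamma\mapsto\mu(C\cap R_\gamma(p,q))$ is continuous on $\mathbb{R}$ and increases (monotonically) from $0$ to $\mu(C)$ as $\gamma$ grows from $m_{pq}$ to $M_{pq}$; moreover $C\cap R_\gamma(p,q)=\emptyset$ for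 $\gamma\le m_{pq}$ and $C\subset R_\gamma(p,q)$ for $\gamma\ge M_{pq}$. For a weight vector $w=(w_1,\dots,w_n)$, the additively weighted Voronoi region of $p_i$ is $\mathrm{VR}_w(p_i,S)=\bigcap_{j\neq i}R_{w_i-w_j}(p_i,p_j)$, i.e. the set of points $z$ with $d_{p_i}(z)-w_i<d_{p_j}(z)-w_j$ for all $j\ne i$. *)

(* Defs.v *)
From HB Require Import structures.
From mathcomp Require Import all_boot all_order all_algebra.
From mathcomp Require Import all_classical all_reals all_analysis.

Set Implicit Arguments.
Unset Strict Implicit.
Unset Printing Implicit Defensive.

Import Order.TTheory GRing.Theory Num.Theory.
Import numFieldNormedType.Exports.

Local Open Scope classical_set_scope.
Local Open Scope ring_scope.

Section Defs.
Variables (R : realType) (d : nat).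
Local Notation V := 'rV[R]_d.

Definition obox (a b : V) : set V :=
  [set x | forall i : 'I_d, a ord0 i < x ord0 i < b ord0 i].
Definition obox_vol (a b : V) : R :=
  \prod_(i < d) Num.max (b ord0 i - a ord0 i) 0.

Definition lebesgue_outer (A : set V) : \bar R :=
  ereal_inf [set s : \bar R | exists a b : nat -> V,
     A `<=` \bigcup_k obox (a k) (b k) /\
     s = (\sum_(0 <= k <oo) (obox_vol (a k) (b k))%:E)%E].

Definition lebesgue_measurable (A : set V) : Prop :=
  forall E : set V,
    lebesgue_outer E = (lebesgue_outer (E `&` A) + lebesgue_outer (E `&` ~` A))%E.

Definition lebesgue_equivalent_measure (mu : set V -> \bar R) : Prop :=
  [/\ mu set0 = 0%E,
      (forall A, lebesgue_measurable A -> (0 <= mu A)%E),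
      (forall F : nat -> set V, (forall k, lebesgue_measurable (F k)) ->
          trivIset setT F ->
          (fun m => (\sum_(0 <= k < m) mu (F k))%E) @ \oo --> mu (\bigcup_k F k))
    & (forall A, lebesgue_measurable A -> (mu A = 0%E <-> lebesgue_outer A = 0%E))].

Variable n : nat.

Definition Rgamma (dist : 'I_n -> V -> R) (i j : 'I_n) (g : R) : set V :=
  [set z | dist i z - dist j z < g].

Definition VR (dist : 'I_n -> V -> R) (w : 'I_n -> R) (i : 'I_n) : set V :=
  \bigcap_(j in [set j | j != i]) Rgamma dist i j (w i - w j).

Definition admissible (mu : set V -> \bar R) (dist : 'I_n -> V -> R) : Prop :=
  forall i j : 'I_n, i != j -> forall C : set V, bounded_set C -> open C ->
  exists m M : R, m < M /\
    continuous (fun g : R => mu (C `&` Rgamma dist i j g)) /\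
    (forall g1 g2 : R, g1 <= g2 ->
       (mu (C `&` Rgamma dist i j g1) <= mu (C `&` Rgamma dist i j g2))%E) /\
    (forall g : R, g <= m -> C `&` Rgamma dist i j g = set0) /\
    (forall g : R, M <= g -> C `<=` Rgamma dist i j g).

Definition path_connected (A : set V) : Prop :=
  forall x y, A x -> A y -> exists f : R -> V,
    [/\ {within `[0, 1], continuous f}, f 0 = x, f 1 = y & f @` `[0, 1] `<=` A].
End Defs.

(* Main.v *)
(** Existence. Normalise [w i0 = 0] and call [w] feasible when every cell other
    than the [i0]-th has measure at most [lam i]. Raising the weight of one site
    enlarges its own cell and shrinks all others; cells vary continuously in
    measure, because two cells differ by sets on which some [dist i - dist j]
    lies in a short interval. Hence the pointwise supremum of the feasible
    weights is feasible, and none of its inequalities can be strict, since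
    otherwise the corresponding weight could still be raised. As the
    cells fill [C] up to a null set, the [i0]-th cell has the right measure too.

    Uniqueness. Let [I] be the set of sites at which [w' - w] is maximal. Passing
    from [w] to [w'] the cells of [I] grow. If [I] is not everything, the
    points where [I] loses under [w] but beats all other sites under [w'] contain
    a nonempty open set [G], by connectedness of [C]. Almost all of [G] goes to
    cells of [I], which therefore strictly gain measure, a contradiction. *)

Require Import Defs.
From HB Require Import structures.
From mathcomp Require Import all_boot all_order all_algebra.
From mathcomp Require Import all_classical all_reals all_analysis.
From mathcomp Require Import measurable_realfun lra.
Import Order.TTheory GRing.Theory Num.Theory.
Import numFieldNormedType.Exports.
Local Open Scope classical_set_scope.
Local Open Scope ring_scope.

(** * Prescribed cell measures *)

(** Measure theory is abstracted away: [p w i] stands for the measure of the [i]-th cell. Taking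
    [v := w] in the third hypothesis gives monotonicity ([pmono]); the fourth makes feasible weights
    exist and bounds them above. *)
Lemma exists_weights (R : realType) (n : nat) (i0 : 'I_n)
    (p : ('I_n -> R) -> 'I_n -> R) (lam : 'I_n -> R) :
  (forall w i, 0 <= p w i) ->
  (forall w, \sum_(i < n) p w i = \sum_(i < n) lam i) ->
  (forall v i e, 0 < e -> exists2 t, 0 < t & forall w w' : 'I_n -> R,
     (forall j, w' i - w' j <= v i - v j + t) ->
     (forall j, v i - v j - t <= w i - w j) -> p w' i <= p w i + e) ->
  (forall i j, i != j -> exists m, forall w, w i - w j <= m -> p w i = 0) ->
  (forall i, 0 < lam i) ->
  exists w, forall i, p w i = lam i.
Proof.
move=> p0 psum psc pvanish lam0.
have pmono w w' i : (forall j, w' i - w' j <= w i - w j) -> p w' i <= p w i.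
  move=> ww'; apply/ler_addgt0Pr => e /(psc w i)[t t0]; apply => j.
    by rewrite (le_trans (ww' j))// lerDl ltW.
  by rewrite lerBlDr lerDl ltW.
have /choice[m mP] (i : 'I_n) : exists m, i != i0 ->
    forall w, w i - w i0 <= m -> p w i = 0.
  have [->|/pvanish[m mP]] := eqVneq i i0; first by exists 0.
  by exists m.
have /choice[M MP] (i : 'I_n) : exists m, i != i0 ->
    forall w, w i0 - w i <= m -> p w i0 = 0.
  have [->|] := eqVneq i i0; first by exists 0.
  by rewrite eq_sym => /pvanish[M MP]; exists M.
pose F : set ('I_n -> R) :=
  [set w | w i0 = 0 /\ forall i, i != i0 -> p w i <= lam i].
have F0 : F (fun i => if i == i0 then 0 else m i).
  split=> [|i ii0]; first by rewrite eqxx.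
  by rewrite mP ?eqxx ?(negbTE ii0) ?subr0// ltW.
(* If [w i] exceeded [- M i], the cell of [i0] would be null, and the other cells, each at most its
   [lam], would miss the total by at least [lam i0]. *)
have Fub w i : F w -> i != i0 -> w i <= - M i.
  move=> [wi0 wlam] ii0; rewrite leNgt; apply/negP => Mw.
  have := psum w; rewrite (bigD1 i0)//= [RHS](bigD1 i0)//=.
  have -> : p w i0 = 0 by apply: (MP i ii0); rewrite wi0 sub0r; lra.
  have : \sum_(j < n | j != i0) p w j <= \sum_(j < n | j != i0) lam j.
    exact: ler_sum.
  by have := lam0 i0; lra.
have supF i : i != i0 -> has_sup [set w i | w in F].
  move=> ii0; split; first by eexists; exists (fun i => if i == i0 then 0 else m i).
  by exists (- M i) => _ [w Fw <-]; exact: Fub.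
pose ws i := if i == i0 then 0 else sup [set w i | w in F].
have wsi0 : ws i0 = 0 by rewrite /ws eqxx.
have ws_ub w i : F w -> w i <= ws i.
  move=> Fw; rewrite /ws; case: ifPn => [/eqP ->|ii0]; first by rewrite Fw.1.
  by apply: sup_upper_bound; [exact: supF|exists w].
(* One feasible [w] close to [ws] at coordinate [i] suffices: its other coordinates lie below [ws],
   which only increases the differences [w i - w j]. *)
have wsle i : i != i0 -> p ws i <= lam i.
  move=> ii0; apply/ler_addgt0Pr => e /(psc ws i)[t t0 tP].
  have [_ [w Fw <-]] := sup_adherent t0 (supF i ii0).
  have -> : sup [set w i | w in F] = ws i by rewrite /ws (negbTE ii0).
  move=> wi; apply: (@le_trans _ _ (p w i + e)); last by rewrite lerD2r Fw.2.
  apply: tP => j; first by rewrite lerDl ltW.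
  by have := ws_ub w j Fw; lra.
have wsE i : i != i0 -> p ws i = lam i.
  move=> ii0; apply/eqP; rewrite eq_le wsle//= leNgt; apply/negP.
  (* The tolerance is the slack [lam i - p ws i], so raising weight [i] by [t] keeps feasibility,
     against the bound [ws_ub]. *)
  rewrite -subr_gt0 => /(psc ws i)[t t0 tP].
  pose w2 j := if j == i then ws i + t else ws j.
  suff /(ws_ub w2 i) : F w2 by rewrite /w2 eqxx gerDl leNgt t0.
  split=> [|k ki0]; first by rewrite /w2 eq_sym (negbTE ii0).
  have [->|ki] := eqVneq k i.
    have := tP ws w2; rewrite addrC subrK; apply => j; last first.
      by rewrite lerBlDr lerDl ltW.
    by rewrite /w2 eqxx; case: (eqVneq j i) => [->|_]; lra.
  apply: (le_trans _ (wsle _ ki0)); apply: pmono => j.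
  by rewrite /w2 (negbTE ki); case: (eqVneq j i) => [->|_]; lra.
exists ws => i; have [->|/wsE//] := eqVneq i i0.
have := psum ws; rewrite (bigD1 i0)//= [RHS](bigD1 i0)//=.
by rewrite (eq_bigr lam) => [/addIr//|j]; exact: wsE.
Qed.

Lemma common_pos (R : realType) (I : finType) (P : I -> R -> Prop) :
  (forall i t s, P i t -> s <= t -> P i s) ->
  (forall i, exists2 t, 0 < t & P i t) -> exists2 t, 0 < t & forall i, P i t.
Proof.
move=> Ple /(_ _)/cid2 tP; pose t i := sval (tP i).
have t0 i : 0 < t i by rewrite /t; case: (tP i).
have Pt i : P i (t i) by rewrite /t; case: (tP i).
(* The default 1 keeps the minimum positive when [I] is empty. *)
exists (\big[Num.min/1]_i t i) => [|i]; first exact/lt_bigmin.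
exact: Ple (Pt i) (bigmin_le_cond _ _ _).
Qed.

Lemma le_measure_finite_cover {disp} {T : measurableType disp} {R : realType}
    (nu : {measure set T -> \bar R}) (I : finType) (P : pred I) (A : set T)
    (B : I -> set T) : (forall i, P i -> measurable (B i)) -> measurable A ->
  A `<=` \bigcup_(i in [set` P]) B i -> (nu A <= \sum_(i | P i) nu (B i))%E.
Proof.
move=> mB mA AB; rewrite bigfs ?index_enum_uniq//; last first.
  by move=> i _; rewrite mem_index_enum.
exact: content_sub_fsum.
Qed.

(** * Cells cut out by finitely many functions in a finite measure space *)

Section Cells.
Context {disp} {T : measurableType disp} {R : realType} {n : nat}.
Variables (nu : {measure set T -> \bar R}) (f : 'I_n -> T -> R).

Definition below (i j : 'I_n) (g : R) : set T := [set z | f i z - f j z < g].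

Definition cell (w : 'I_n -> R) (i : 'I_n) : set T :=
  \bigcap_(j in [set j | j != i]) below i j (w i - w j).

(** Half-open, so that it is exactly a difference of two sets [below]. *)
Definition band (i j : 'I_n) (g t : R) : set T :=
  [set z | g - t <= f i z - f j z < g + t].

Hypothesis mbelow : forall i j g, measurable (below i j g).
Hypothesis nufin : (nu setT < +oo)%E.
Hypothesis nu_continuous :
  forall i j, i != j -> continuous (fun g => nu (below i j g)).

Let nufinA A : measurable A -> nu A \is a fin_num.
Proof.
move=> mA; rewrite ge0_fin_numE//; apply: le_lt_trans nufin.
by apply: le_measure; rewrite ?inE.
Qed.

Lemma bandE i j g t : band i j g t = below i j (g + t) `\` below i j (g - t).
Proof.
apply/seteqP; split => z /=; rewrite /band /below /=.
  by move=> /andP[? ?]; split => //; apply/negP; rewrite -leNgt.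
by move=> [-> /negP]; rewrite -leNgt => ->.
Qed.

Lemma measurable_band i j g t : measurable (band i j g t).
Proof. by rewrite bandE; exact: measurableD. Qed.

Lemma measurable_cell w i : measurable (cell w i).
Proof. by apply: fin_bigcap_measurable => //; exact: finite_finset. Qed.

(** The measure of a band is the increment of the continuous function [nu (below i j _)] between
    [g - t] and [g + t]. *)
Lemma band_small i j g e : i != j -> 0 < e ->
  exists2 t, 0 < t & (nu (band i j g t) <= e%:E)%E.
Proof.
move=> ij e0; pose h x := fine (nu (below i j x)).
have hE x : nu (below i j x) = (h x)%:E by rewrite fineK// nufinA.
have /cvgrPdist_le/(_ (e / 2)) : h @ g --> h g.
  apply: (@fine_cvg _ _ _ _ (fun x => nu (below i j x))).
  by rewrite -hE; exact: nu_continuous.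
rewrite divr_gt0// => /(_ isT) [r /= r0 rP].
have t0 : 0 < r / 2 by rewrite divr_gt0.
have hlt s : `|s| <= r / 2 -> `|h g - h (g + s)| <= e / 2.
  move=> sr; apply: rP => /=; rewrite opprD addNKr normrN.
  by apply: (le_lt_trans sr); rewrite gtr_pMr// invf_lt1 ?ltr1n.
exists (r / 2) => //.
rewrite bandE measureD//; last by rewrite -ge0_fin_numE// nufinA.
rewrite setIidr; last by move=> z; rewrite /below /= => /lt_trans; apply; lra.
rewrite -[leLHS]/(nu (below i j (g + r / 2)) - nu (below i j (g - r / 2)))%E.
rewrite !hE -EFinD lee_fin.
have := hlt (r / 2); have := hlt (- (r / 2)); rewrite normrN gtr0_norm// lexx.
by move=> /(_ isT) + /(_ isT); rewrite !ler_norml => /andP[? ?] /andP[? ?]; lra.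
Qed.

Lemma bandS i j g t s : s <= t -> band i j g s `<=` band i j g t.
Proof. by move=> st z /= /andP[? ?]; apply/andP; split; lra. Qed.


Lemma bands_small (I : finType) (P : pred I) (a b : I -> 'I_n) (g : I -> R) e :
  (forall i, P i -> a i != b i) -> 0 < e ->
  exists2 t, 0 < t &
    (\sum_(i | P i) nu (band (a i) (b i) (g i) t) <= e%:E)%E.
Proof.
move=> ab e0; pose N : R := #|I|.+1%:R; have N0 : 0 < N by rewrite ltr0n.
have [||t t0 tP] := @common_pos R I
    (fun i t => P i -> (nu (band (a i) (b i) (g i) t) <= (e / N)%:E)%E).
- move=> i t s tP st Pi; apply: le_trans (tP Pi).
  by apply: le_measure; rewrite ?inE; [exact: measurable_band..|exact: bandS].
- move=> i; case: (boolP (P i)) => [Pi|_]; last by exists 1.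
  have [t t0 tP] := band_small _ _ (g i) _ (ab i Pi) (divr_gt0 e0 N0).
  by exists t.
exists t => //; apply: (@le_trans _ _ (\sum_(i : I | P i) (e / N)%:E)%E).
  exact: lee_sum.
rewrite sumEFin lee_fin sumr_const -mulr_natr -mulrA ger_pMr// mulrC.
by rewrite ler_pdivrMr// mul1r ler_nat (leq_trans (max_card _)).
Qed.

(* The tolerance [t] depends only on [v], so the statement bounds cells both for
   weights increasing to [v] and for weights decreasing to [v]. *)
Lemma cell_semicontinuous v i e : 0 < e -> exists2 t, 0 < t &
  forall w w' : 'I_n -> R, (forall j, w' i - w' j <= v i - v j + t) ->
    (forall j, v i - v j - t <= w i - w j) ->
    (nu (cell w' i) <= nu (cell w i) + e%:E)%E.
Proof.
move=> e0; have [|t t0 tP] := @bands_small _ (fun j => j != i) (fun=> i) id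
  (fun j => v i - v j) e _ e0; first by move=> j; rewrite eq_sym.
exists t => // w w' w't wt.
pose B := \bigcup_(j in [set j | j != i]) band i j (v i - v j) t.
have mB : measurable B.
  apply: fin_bigcup_measurable => [|j _]; first exact: finite_finset.
  exact: measurable_band.
apply: (@le_trans _ _ (nu (cell w i `|` B))).
  apply: le_measure; rewrite ?inE; first exact: measurable_cell.
    by apply: measurableU => //; exact: measurable_cell.
  (* A point in the cell of [w'] but not in that of [w] violates the inequality of [w] for some [j];
     this traps [f i z - f j z] in a band. *)
  move=> z zw'; have [zB|zB] := pselect (B z); [by right|left] => j /= ji.
  rewrite /below /= ltNge; apply/negP => zj; apply: zB; exists j => //=.
  have := zw' j ji; rewrite /below /band /= => zj'.
  by apply/andP; split; [apply: le_trans zj|apply: lt_le_trans zj' _].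
apply: (le_trans (measureU2 _ (measurable_cell _ _) mB)); apply: leeD => //.
apply: le_trans tP; apply: le_measure_finite_cover => // j _.
exact: measurable_band.
Qed.

Lemma cells_trivIset w : trivIset setT (cell w).
Proof.
apply/trivIsetP => i j _ _ ij; rewrite -subset0 => z [/(_ j)].
rewrite /below /= eq_sym => /(_ ij) + /(_ i ij); rewrite /below /=; lra.
Qed.



(** Outside all cells, a minimiser [i] of [f i z - w i] ties with some [j], so the point lies in the
    bands around [w i - w j] of every width, and these have arbitrarily small total measure. *)
Lemma cells_full (i0 : 'I_n) w : nu (~` \bigcup_i cell w i) = 0%E.
Proof.
have mA : measurable (~` \bigcup_i cell w i).
  apply: measurableC; apply: fin_bigcup_measurable => [|i _].
    exact: finite_finset.
  exact: measurable_cell.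
apply/eqP; rewrite eq_le measure_ge0 andbT; apply/lee_addgt0Pr => e e0.
rewrite add0e; have [|t t0] := @bands_small ('I_n * 'I_n)%type
  (fun q => q.1 != q.2) fst snd (fun q => w q.1 - w q.2) e _ e0; first by [].
apply: le_trans; apply: le_measure_finite_cover => // [q _|z zcell].
  exact: measurable_band.
have [i _ imin] := @arg_minP _ _ _ i0 xpredT (fun i => f i z - w i) isT.
have /existsNP[j /not_implyP[ji /negP]] : ~ cell w i z.
  by move=> zi; apply: zcell; exists i.
rewrite -leNgt => zij; exists (i, j).
  by apply: contraTT ji => /negPn/eqP /= ->; rewrite eqxx.
by have := imin j isT; rewrite /band /= => ?; apply/andP; split; lra.
Qed.

(** For uniqueness: since the cells fill the space up to a null set, nullity can be tested cell by
    cell. *)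
Lemma null_of_cells (i0 : 'I_n) w (G : set T) : measurable G ->
  (forall i, nu (G `&` cell w i) = 0%E) -> nu G = 0%E.
Proof.
move=> mG Gnull.
have mcells : measurable (\bigcup_i cell w i).
  apply: fin_bigcup_measurable => [|i _]; first exact: finite_finset.
  exact: measurable_cell.
apply: (@subset_measure0 _ _ _ nu _
    ((~` \bigcup_i cell w i) `|` \bigcup_i (G `&` cell w i))) => //.
- apply: measurableU; first exact: measurableC.
  by rewrite -setI_bigcupr; exact: measurableI.
- move=> z Gz; have [[i _ zi]|zcell] := pselect ((\bigcup_i cell w i) z);
    last by left.
  by right; exists i.
apply: null_set_setU; [exact: measurableC| |exact: (cells_full i0)|].
  by rewrite -setI_bigcupr; exact: measurableI.
apply/eqP; rewrite -measure_le0.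
apply: (@le_trans _ _ (\sum_(i < n) nu (G `&` cell w i))%E); last by rewrite big1.
apply: le_measure_finite_cover => [i _||z [i _ zi]]; last by exists i.
  by apply: measurableI => //; exact: measurable_cell.
by rewrite -setI_bigcupr; exact: measurableI.
Qed.

Lemma sum_nu_cell (i0 : 'I_n) w : (\sum_(i < n) nu (cell w i) = nu setT)%E.
Proof.
have mcells : measurable (\bigcup_i cell w i).
  apply: fin_bigcup_measurable => [|i _]; first exact: finite_finset.
  exact: measurable_cell.
have -> : nu setT = (nu (~` \bigcup_i cell w i) + nu (\bigcup_i cell w i))%E.
  rewrite -(setvU (\bigcup_i cell w i)) measureU ?setICl//.
  exact: measurableC.
rewrite (cells_full i0) add0e measure_fin_bigcup; last 3 first.
- exact: finite_finset.
- exact: cells_trivIset.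
- by move=> i _; exact: measurable_cell.
rewrite bigfs ?index_enum_uniq//; first by apply: eq_fsbigl; apply/seteqP.
by move=> i _; rewrite mem_index_enum.
Qed.

Lemma exists_cells (i0 : 'I_n) (lam : 'I_n -> R) :
  (forall i j, i != j -> exists m, forall g, g <= m -> nu (below i j g) = 0%E) ->
  (forall i, 0 < lam i) -> (\sum_(i < n) (lam i)%:E)%E = nu setT ->
  exists w, forall i, nu (cell w i) = (lam i)%:E.
Proof.
move=> nu0 lam0 lamE; pose p w i := fine (nu (cell w i)).
have pE w i : (p w i)%:E = nu (cell w i).
  by rewrite fineK// nufinA//; exact: measurable_cell.
have [||v i e e0|i j ij||w wP] := @exists_weights R n i0 p lam.
- by move=> w i; rewrite fine_ge0.
- move=> w; apply: EFin_inj; rewrite -!sumEFin lamE -(sum_nu_cell i0 w).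
  by apply: eq_bigr => i _; rewrite pE.
- have [t t0 tP] := cell_semicontinuous v i e e0; exists t => // w w' h1 h2.
  by rewrite -lee_fin EFinD !pE tP.
- have [m mP] := nu0 i j ij; exists m => w /mP b0.
  apply: EFin_inj; rewrite pE; apply/eqP; rewrite -measure_le0 -b0.
  apply: le_measure; rewrite ?inE//; first exact: measurable_cell.
  by move=> z; apply => /=; rewrite eq_sym.
- by [].
by exists w => i; rewrite -pE wP.
Qed.
End Cells.

(** * Lebesgue outer measure *)

Section LebesgueOuter.
Context {R : realType}.
Implicit Types d : nat.

Lemma obox_vol_ge0 {d} (a b : 'rV[R]_d) : 0 <= obox_vol a b.
Proof. by apply: prodr_ge0 => i _; rewrite le_max lexx orbT. Qed.

Lemma obox_vol0 {d} (a : 'rV[R]_d.+1) : obox_vol a a = 0.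
Proof. by rewrite /obox_vol big_ord_recl subrr maxxx mul0r. Qed.

(** A set that is not an open box gets [+oo], the infimum of the empty set. *)
Definition box_content {d} (A : set 'rV[R]_d) : \bar R :=
  ereal_inf [set (obox_vol c.1 c.2)%:E | c in [set c | A = obox c.1 c.2]].

Lemma box_content_ge0 {d} (A : set 'rV[R]_d) : (0 <= box_content A)%E.
Proof. by apply: le_ereal_inf_tmp => _ [c _ <-]; rewrite lee_fin obox_vol_ge0. Qed.

Lemma box_content0 {d} : box_content (@set0 'rV[R]_d.+1) = 0%E.
Proof.
apply/eqP; rewrite eq_le box_content_ge0 andbT; apply: ereal_inf_lbound.
exists (0, 0) => /=; last by rewrite obox_vol0.
by apply/esym; rewrite -subset0 => x /(_ ord0); rewrite lt_asym.
Qed.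

(* Declaring every set measurable turns the library's outer extension into an
   infimum over covers by arbitrary sets. *)
Lemma lebesgue_outer_mu_ext {d} (A : set 'rV[R]_d) :
  lebesgue_outer A =
  mu_ext (@box_content d : set (g_sigma_algebraType [set: set 'rV[R]_d]) -> _) A.
Proof.
apply/eqP; rewrite eq_le; apply/andP; split.
  apply: le_ereal_inf_tmp => _ [F [_ AF] <-].
  have [[k Foo]|Ffin] := pselect (exists k, box_content (F k) = +oo%E).
    rewrite (eseries_pinfty _ _ Foo) ?leey// => m _.
    by rewrite -ltNye (lt_le_trans _ (box_content_ge0 _)).
  apply/lee_addgt0Pr => e e0.
  (* Finite content forces [F k] to be a box; the errors [e / 2 ^ k.+1] sum to [e]. *)
  have /choice[c cP] k : exists c : 'rV[R]_d * 'rV[R]_d, F k = obox c.1 c.2 /\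
      ((obox_vol c.1 c.2)%:E <= box_content (F k) + (e / (2 ^ k.+1)%:R)%:E)%E.
    have Fk : box_content (F k) \is a fin_num.
      rewrite ge0_fin_numE ?box_content_ge0// ltey; apply/eqP => Foo.
      by apply: Ffin; exists k.
    have /lb_ereal_inf_adherent/(_ Fk)[_ [c Fc <-] cle] : 0 < e / (2 ^ k.+1)%:R.
      by rewrite divr_gt0// ltr0n expn_gt0.
    by exists c; split => //; exact: ltW.
  apply: (@le_trans _ _ (\sum_(k <oo) (obox_vol (c k).1 (c k).2)%:E)%E).
    apply: ereal_inf_lbound; exists (fst \o c), (snd \o c); split => //.
    by move=> x /AF[k _]; rewrite (cP k).1 => ?; exists k.
  apply: le_trans (epsilon_trick xpredT _ (ltW e0)); last first.
    by move=> k; exact: box_content_ge0.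
  by apply: lee_nneseries => k _; [rewrite lee_fin obox_vol_ge0|exact: (cP k).2].
apply: le_ereal_inf_tmp => _ [a [b [Aab ->]]].
apply: (@le_trans _ _ (\sum_(k <oo) box_content (obox (a k) (b k)))%E).
  apply: ereal_inf_lbound; exists (fun k => obox (a k) (b k)) => //.
  by split=> // k; apply: sub_sigma_algebra.
apply: lee_nneseries => [k _ _|k _]; first exact: box_content_ge0.
by apply: ereal_inf_lbound; exists (a k, b k).
Qed.

Lemma lebesgue_outer0 {d} : lebesgue_outer (@set0 'rV[R]_d.+1) = 0%E.
Proof.
rewrite lebesgue_outer_mu_ext; apply: mu_ext0; first exact: box_content0.
by move=> A; exact: box_content_ge0.
Qed.

Lemma lebesgue_outer_ge0 {d} (A : set 'rV[R]_d) : (0 <= lebesgue_outer A)%E.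
Proof.
rewrite lebesgue_outer_mu_ext; apply: mu_ext_ge0 => B.
exact: box_content_ge0.
Qed.

Lemma le_lebesgue_outer {d} :
  {homo @lebesgue_outer R d : A B / A `<=` B >-> (A <= B)%E}.
Proof. by move=> A B AB; rewrite !lebesgue_outer_mu_ext; exact: le_mu_ext. Qed.

Lemma lebesgue_outer_sigma_subadditive {d} :
  sigma_subadditive (@lebesgue_outer R d).
Proof.
move=> F; rewrite lebesgue_outer_mu_ext.
rewrite (eq_eseriesr (fun k _ => lebesgue_outer_mu_ext (F k))).
apply: mu_ext_sigma_subadditive; exact: box_content_ge0.
Qed.

(** The Caratheodory sets of this outer measure are, by unfolding, the [lebesgue_measurable] ones.
    The dimension is [d.+1] because the empty set must have outer measure 0. *)
HB.instance Definition _ d := isOuterMeasure.Build R 'rV[R]_d.+1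
  (@lebesgue_outer R d.+1) (@lebesgue_outer0 d) (@lebesgue_outer_ge0 d.+1)
  (@le_lebesgue_outer d.+1) (@lebesgue_outer_sigma_subadditive d.+1).

End LebesgueOuter.

(** * Half-spaces and open sets are Lebesgue measurable *)

Section LebesgueMeasurable.
Context {R : realType} {d : nat}.
Local Notation V := 'rV[R]_d.+1.

Definition set_coord (a : V) (i : 'I_d.+1) (t : R) : V :=
  \row_j if j == i then t else a ord0 j.

Lemma obox_volD1 (a b : V) i :
  obox_vol a b = Num.max (b ord0 i - a ord0 i) 0 *
    \prod_(j < d.+1 | j != i) Num.max (b ord0 j - a ord0 j) 0.
Proof. by rewrite /obox_vol (bigD1 i). Qed.

Lemma obox_vol_set_coord (a b : V) i s t :
  obox_vol (set_coord a i s) (set_coord b i t) = Num.max (t - s) 0 *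
    \prod_(j < d.+1 | j != i) Num.max (b ord0 j - a ord0 j) 0.
Proof.
rewrite (obox_volD1 _ _ i) !mxE eqxx; congr (_ * _).
by apply: eq_bigr => j /negPf ji; rewrite !mxE ji.
Qed.

(** The hyperplane [x_i = c] cuts each covering box into two boxes. Their volumes exceed that of the
    box by at most [eps k], and these costs sum to [e]. *)
Lemma halfspace_measurable i (c : R) :
  lebesgue_measurable [set x : V | x ord0 i < c].
Proof.
apply: le_caratheodory_measurable => X.
apply: le_ereal_inf_tmp => _ [a [b [Xab ->]]].
apply/lee_addgt0Pr => e e0.
pose P k : R := \prod_(j < d.+1 | j != i) Num.max (b k ord0 j - a k ord0 j) 0.
have P0 k : 0 <= P k by apply: prodr_ge0 => j _; rewrite le_max lexx orbT.
pose eps k : R := e / (2 ^ k.+1)%:R.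
have eps0 k : 0 < eps k by rewrite divr_gt0// ltr0n expn_gt0.
(* The summand 1 guards against [P k = 0]. *)
pose dlt k := eps k / (1 + P k).
have P1 k : 0 < 1 + P k by rewrite ltr_pwDl.
have dlt0 k : 0 < dlt k by rewrite divr_gt0.
have dltP k : dlt k * P k <= eps k.
  rewrite /dlt mulrAC ler_pdivrMr// ler_wpM2l ?ltW//; lra.
pose b1 k := set_coord (b k) i (Num.min (b k ord0 i) c).
(* The boxes are open: to cover [c <= x_i] they must start slightly below [c]. *)
pose a2 k := set_coord (a k) i (Num.max (a k ord0 i) (c - dlt k)).
have a_id k : a k = set_coord (a k) i (a k ord0 i).
  by apply/rowP => j; rewrite !mxE; case: eqVneq => // ->.
have b_id k : b k = set_coord (b k) i (b k ord0 i).
  by apply/rowP => j; rewrite !mxE; case: eqVneq => // ->.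
have vol12 k : obox_vol (a k) (b1 k) + obox_vol (a2 k) (b k) <=
    obox_vol (a k) (b k) + eps k.
  apply: (@le_trans _ _ (obox_vol (a k) (b k) + dlt k * P k)); last first.
    by rewrite lerD2l.
  rewrite (_ : obox_vol (a k) (b1 k) =
      Num.max (Num.min (b k ord0 i) c - a k ord0 i) 0 * P k); last first.
    by rewrite {1}(a_id k) obox_vol_set_coord.
  rewrite (_ : obox_vol (a2 k) (b k) =
      Num.max (b k ord0 i - Num.max (a k ord0 i) (c - dlt k)) 0 * P k); last first.
    by rewrite {1}(b_id k) obox_vol_set_coord.
  rewrite (obox_volD1 _ _ i) -!mulrDl ler_wpM2r//.
  have := dlt0 k; move: (dlt k) (a k ord0 i) (b k ord0 i) => t x y t0.
  by rewrite !maxEle !minEle; repeat case: ifPn; rewrite -?ltNge; lra.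
apply: (@le_trans _ _ (\sum_(k <oo) (obox_vol (a k) (b1 k))%:E +
    \sum_(k <oo) (obox_vol (a2 k) (b k))%:E)%E).
  apply: leeD; apply: ereal_inf_lbound.
    exists a, b1; split=> // x [/Xab[k _ xk] xc]; exists k => // j.
    rewrite !mxE; case: eqVneq => [->|_]; last exact: xk.
    by rewrite lt_min xc andbT; exact: xk.
  exists a2, b; split=> // x [/Xab[k _ xk] /negP]; rewrite -leNgt => cx.
  exists k => // j; rewrite !mxE; case: eqVneq => [->|_]; last exact: xk.
  have := xk i; have := dlt0 k; rewrite gt_max => ? /andP[-> ->].
  by rewrite andbT/=; lra.
rewrite -nneseriesD; try by move=> k _ _; rewrite lee_fin obox_vol_ge0.
apply: le_trans (epsilon_trick xpredT _ (ltW e0)); last first.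
  by move=> k; rewrite lee_fin obox_vol_ge0.
apply: lee_nneseries => k _; rewrite -EFinD lee_fin.
  by move=> _; rewrite addr_ge0 ?obox_vol_ge0.
exact: vol12.
Qed.

(** An open set is the countable union of the rational boxes inside it, taken half-open so that they
    are built from differences of half-spaces. *)
Lemma open_lebesgue_measurable (U : set V) : open U -> lebesgue_measurable U.
Proof.
move=> oU.
pose Q (q : 'rV[rat]_d.+1 * 'rV[rat]_d.+1) :
    set (caratheodory_type (@lebesgue_outer R d.+1)) :=
  \bigcap_i ([set x : V | x ord0 i < ratr (q.2 ord0 i)] `\`
             [set x : V | x ord0 i < ratr (q.1 ord0 i)]).
suff -> : U = \bigcup_q (if `[< Q q `<=` U >] then Q q else set0).
  apply: (@countable_bigcupT_measurable _
    (caratheodory_type (@lebesgue_outer R d.+1))) => [|q]; first exact: countableP.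
  case: ifPn => _; last exact: measurable0.
  apply: fin_bigcap_measurable => [|i _]; first exact: finite_finset.
  by apply: measurableD; exact: halfspace_measurable.
apply/seteqP; split => [x Ux|x [q _]]; last first.
  by case: ifPn => // /asboolP; apply.
have /nbhs_ballP[e /= e0 xeU] : nbhs x U by exact: open_nbhs_nbhs.
have /choice[q qP] i : exists q : rat * rat,
    (ratr q.1 \in `]x ord0 i - e, x ord0 i[) /\
    (ratr q.2 \in `]x ord0 i, x ord0 i + e[).
  have [q1 ?] := @rat_in_itvoo R (x ord0 i - e) (x ord0 i) ltac:(lra).
  have [q2 ?] := @rat_in_itvoo R (x ord0 i) (x ord0 i + e) ltac:(lra).
  by exists (q1, q2).
exists (\row_i (q i).1, \row_i (q i).2) => //.
case: ifPn => [_|/asboolP[]].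
  move=> i _; rewrite /= !mxE; have [] := qP i; rewrite !in_itv/=.
  by move=> /andP[_ ?] /andP[? _]; split=> //; apply/negP; rewrite -leNgt ltW.
move=> y Qy; apply: xeU; split=> // k i; rewrite ord1.
have := Qy i I; rewrite /= !mxE; have [] := qP i; rewrite !in_itv/=.
move=> /andP[? _] /andP[_ ?] [? /negP]; rewrite -leNgt => ?.
by rewrite /ball /= ltr_norml; apply/andP; split; lra.
Qed.

End LebesgueMeasurable.

(** * Lower bounds for the outer measure of boxes and open sets *)

Lemma interval_cover_le {R : realType} (c l r : R) (C L U : nat -> R) :
  0 <= c -> (forall k, 0 <= C k) ->
  (forall t, ((c * \1_`]l, r[ t)%:E <=
     \sum_(k <oo) (C k * \1_`]L k, U k[ t)%:E)%E) ->
  ((c * Num.max (r - l) 0)%:E <= \sum_(k <oo) (C k * Num.max (U k - L k) 0)%:E)%E.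
Proof.
move=> c0 C0 cover.
have len (x y : R) : (\int[lebesgue_measure]_t (\1_`]x, y[ t)%:E =
    (Num.max (y - x) 0)%:E)%E.
  transitivity (lebesgue_measure (`]x, y[%classic : set R)).
    by rewrite integral_indic// setIT.
  rewrite lebesgue_measure_itv/= lte_fin.
  case: ltP => xy; first by rewrite max_l// subr_ge0 ltW.
  by rewrite max_r// subr_le0.
have mf (x : R) (y z : R) :
    measurable_fun setT (fun t : R => (x * \1_`]y, z[ t)%:E).
  by apply/measurable_EFinP; apply: measurable_funM.
have f0 (x : R) (y z t : R) : 0 <= x -> (0 <= (x * \1_`]y, z[ t)%:E)%E.
  by move=> x0; rewrite lee_fin mulr_ge0.
have lenZ (x y z : R) : 0 <= x ->
    (\int[lebesgue_measure]_t (x * \1_`]y, z[ t)%:E =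
    (x * Num.max (z - y) 0)%:E)%E.
  move=> x0; under eq_integral do rewrite EFinM.
  rewrite ge0_integralZl_EFin ?len//.
  exact/measurable_EFinP.
(* Both sides become integrals over [t] of the two sides of [cover], with sum and integral exchanged
   by nonnegativity. *)
rewrite -lenZ//; rewrite (eq_eseriesr (fun k _ => esym (lenZ _ _ _ (C0 k)))).
rewrite -integral_nneseries//;
  last by move=> k t _; exact: f0.
apply: ge0_le_integral => //; [by move=> t _; exact: f0|exact: mf|].
refine (@ge0_emeasurable_sum _ _ _ setT
  (fun k t => (C k * \1_`]L k, U k[ t)%:E) xpredT _ _) => [k t _ _|k _].
  exact: f0.
  exact: mf.
by move=> k; exact: mf.
Qed.

Section OuterBox.
Context {R : realType} {d : nat}.
Local Notation V := 'rV[R]_d.+1.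

(* The indicator of the box [a, b], integrated over its first [m] coordinates. *)
Definition slice (m : nat) (a b x : V) : R :=
  \prod_(i < d.+1) if (i < m)%N then Num.max (b ord0 i - a ord0 i) 0
                   else \1_`]a ord0 i, b ord0 i[ (x ord0 i).

(** At [m = i] this is the factor common to [slice i] and [slice i.+1], which differ only in
    coordinate [i]. *)
Definition slice' (m : nat) (i : 'I_d.+1) (a b x : V) : R :=
  \prod_(j < d.+1 | j != i) if (j < m)%N then Num.max (b ord0 j - a ord0 j) 0
                            else \1_`]a ord0 j, b ord0 j[ (x ord0 j).

Lemma slice_set_coord (i : 'I_d.+1) a b x t : slice i a b (set_coord x i t) =
  slice' i i a b x * \1_`]a ord0 i, b ord0 i[ t.
Proof.
rewrite /slice (bigD1 i)//= ltnn mxE eqxx mulrC; congr (_ * _).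
by apply: eq_bigr => j /negPf ji; rewrite mxE ji.
Qed.

Lemma sliceS (i : 'I_d.+1) a b x : slice i.+1 a b x =
  slice' i i a b x * Num.max (b ord0 i - a ord0 i) 0.
Proof.
rewrite /slice (bigD1 i)//= ltnSn mulrC; congr (_ * _).
by apply: eq_bigr => j /negPf ji; rewrite ltnS leq_eqVlt val_eqE ji.
Qed.

Lemma slice'_ge0 m i a b x : 0 <= slice' m i a b x.
Proof.
by apply: prodr_ge0 => j _; case: ifP => // _; rewrite le_max lexx orbT.
Qed.

Lemma slice0 a b x : slice 0 a b x = \1_(obox a b) x.
Proof.
rewrite /slice indicE; case: (boolP (x \in obox a b)) => [/set_mem xab|/negP xab].
  by rewrite big1// => i _; rewrite indicE mem_set//= in_itv/=; exact: xab.
have [i xi] : exists i, x ord0 i \notin `]a ord0 i, b ord0 i[.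
  apply/not_existsP => H; apply: xab; apply/mem_set => i.
  by have /negP/negPn := H i; rewrite in_itv.
by rewrite (bigD1 i)//= indicE memNset ?mul0r//=; exact/negP.
Qed.

Lemma slice_full a b x : slice d.+1 a b x = obox_vol a b.
Proof. by apply: eq_bigr => i _; rewrite ltn_ord. Qed.

(* Integrating the pointwise inequality between the indicators of a box and of its
   cover one coordinate at a time avoids compactness. *)
Lemma obox_vol_le_outer (a b : V) :
  ((obox_vol a b)%:E <= lebesgue_outer (obox a b))%E.
Proof.
apply: le_ereal_inf_tmp => _ [A [B [cover ->]]].
suff H m : (m <= d.+1)%N -> forall x,
    ((slice m a b x)%:E <= \sum_(k <oo) (slice m (A k) (B k) x)%:E)%E.
  have := H d.+1 (leqnn _) 0; rewrite slice_full => /le_trans; apply.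
  by under eq_eseriesr do rewrite slice_full.
elim: m => [_ x|m IH md x].
  have [/cover[k _ xk]|xab] := pselect (obox a b x); last first.
    rewrite slice0 indicE memNset//; apply: nneseries_ge0 => k _ _.
    by rewrite slice0.
  apply: (@le_trans _ _ (slice 0 (A k) (B k) x)%:E).
    by rewrite !slice0 !indicE (mem_set xk) lee_fin lern1 leq_b1.
  rewrite (@nneseriesD1 _ _ k)//; last by move=> ? _; rewrite slice0.
  by rewrite leeDl// nneseries_ge0// => ? _ _; rewrite slice0.
have {}IH := IH (ltnW md); pose i := Ordinal md.
rewrite (sliceS i); under eq_eseriesr do rewrite (sliceS i).
(* As a function of coordinate [i] alone, each slice is a constant [slice'] times the indicator of
   an interval. *)
apply: interval_cover_le => [|k|t]; [exact: slice'_ge0..|].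
have := IH (set_coord x i t).
rewrite (slice_set_coord i).
by under eq_eseriesr do rewrite (slice_set_coord i).
Qed.

Lemma open_lebesgue_outer_gt0 (U : set V) : open U -> U !=set0 ->
  (0 < lebesgue_outer U)%E.
Proof.
move=> oU [x Ux].
have /nbhs_ballP[e /= e0 xeU] : nbhs x U by exact: open_nbhs_nbhs.
(* Balls of row vectors are cubes, so this open box lies in [U]. *)
pose a : V := \row_i (x ord0 i - e); pose b : V := \row_i (x ord0 i + e).
apply: (@lt_le_trans _ _ (obox_vol a b)%:E).
  by rewrite lte_fin; apply: prodr_gt0 => i _; rewrite !mxE lt_max; lra.
apply: (le_trans (obox_vol_le_outer a b)); apply: le_lebesgue_outer => y yab.
apply: xeU; split=> // k i; rewrite ord1 /ball /= ltr_norml.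
by have := yab i; rewrite !mxE => /andP[? ?]; apply/andP; split; lra.
Qed.
End OuterBox.

(** * Voronoi regions in a path-connected set *)

Lemma open_finite_bigcap {T : topologicalType} (I : finType) (P : pred I)
    (f : I -> set T) :
  (forall i, P i -> open (f i)) -> open (\bigcap_(i in [set` P]) f i).
Proof.
move=> fo; rewrite (_ : bigcap _ _ = \big[setI/setT]_(i | P i) f i).
  by apply: big_ind => //; [exact: openT|exact: openI].
rewrite -bigcap_seq_cond; congr bigcap; apply/seteqP; split => i /=.
  by rewrite mem_index_enum.
by case/andP.
Qed.

(** Otherwise [U] and [W] would disconnect the image of a path in [C] from a point of [U] to a point
    of [W]. *)
Lemma path_connected_overlap {R : realType} {d : nat} (C U W : set 'rV[R]_d) :
  path_connected C -> open U -> open W -> C `<=` U `|` W ->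
  C `&` U !=set0 -> C `&` W !=set0 -> C `&` U `&` W !=set0.
Proof.
move=> pC oU oW CUW [x [Cx Ux]] [y [Cy Wy]]; apply/set0P/negP => /eqP CUW0.
have [f [cf f0 f1 fC]] := pC x y Cx Cy.
have K0 : (f @` `[0, 1]) x by exists 0; rewrite //= in_itv/= lexx ler01.
have K1 : (f @` `[0, 1]) y by exists 1; rewrite //= in_itv/= lexx ler01.
have Kconn := connected_continuous_connected (@segment_connected R 0 1) cf.
have KU : f @` `[0, 1] `&` U = f @` `[0, 1].
  apply: Kconn; [by exists x|by exists U|].
  exists (~` W); first exact: open_closedC.
  apply/seteqP; split => z [Kz Uz]; split => //.
    by move=> Wz; rewrite -[False]/(set0 z) -CUW0; split=> //; split=> //; exact: fC.
  by have [//|] := CUW z (fC _ Kz).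
rewrite -[False]/(set0 y) -CUW0; split=> //; split=> //.
by move: K1; rewrite -KU => -[].
Qed.

Section Separation.
Context {R : realType} {d n : nat}.
Variable dist : 'I_n -> 'rV[R]_d -> R.
Hypothesis dist_continuous : forall i, continuous (dist i).

Lemma open_Rgamma i j g : open (Rgamma dist i j g).
Proof.
have : continuous (dist i \- dist j).
  by move=> z; apply: continuousB; exact: dist_continuous.
by move=> /continuousP/(_ [set x | x < g] (@open_lt _ _)).
Qed.

Lemma open_VR w i : open (VR dist w i).
Proof. by apply: open_finite_bigcap => j _; exact: open_Rgamma. Qed.

(** The second alternative is for the sites where [w' - w] is maximal, the first for all others. *)
Lemma separating_open (C : set 'rV[R]_d) (w w' : 'I_n -> R) :
  open C -> path_connected C -> (forall i, C `&` VR dist w i !=set0) ->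
  ~ (exists c, forall i, w' i = w i + c) ->
  exists G, [/\ open G, G !=set0, G `<=` C & forall i,
    G `&` VR dist w' i = set0 \/
    (VR dist w i `<=` VR dist w' i /\ G `&` VR dist w i = set0)].
Proof.
move=> oC pC VR0 ww'; pose dl i := w' i - w i.
have [i0 _] : exists i0 : 'I_n, True.
  by apply/not_existsP => n0; apply: ww'; exists 0 => i; have := n0 i.
have [k _ kmax] := @arg_maxP _ _ _ i0 xpredT dl isT.
have {}kmax i : dl i <= dl k by exact: kmax.
have [j0 j0k] : exists j0, dl j0 < dl k.
  apply/not_existsP => H; apply: ww'; exists (dl k) => i.
  by have := H i; have := kmax i; rewrite /dl; lra.
have [m mk mmax] := @arg_maxP _ _ _ j0 [pred j | dl j < dl k] dl j0k.
(* As [m] has the largest non-maximal [dl], every maximal site gains at least [e] over every other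
   site from [w] to [w']. Hence on [A] some maximal site beats all others under [w']; on [B] some
   other site beats all maximal ones under [w]. The slack [e] puts ties under [w] into [A], so [A]
   and [B] cover [C]. *)
pose e := dl k - dl m.
have e0 : 0 < e by rewrite subr_gt0.
pose A := \bigcup_(i in [set i | dl i == dl k])
  \bigcap_(j in [set j | dl j < dl k]) Rgamma dist i j (w i - w j + e).
pose B := \bigcup_(j in [set j | dl j < dl k])
  \bigcap_(i in [set i | dl i == dl k]) Rgamma dist j i (w j - w i).
have oA : open A.
  apply: bigcup_open => i _; apply: open_finite_bigcap => j _.
  exact: open_Rgamma.
have oB : open B.
  apply: bigcup_open => i _; apply: open_finite_bigcap => j _.
  exact: open_Rgamma.
have CAB : C `<=` A `|` B.
  move=> z _; have [Bz|nBz] := pselect (B z); [by right|left].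
  have [i ik imin] := @arg_minP _ _ _ k [pred i | dl i == dl k]
    (fun i => dist i z - w i) (eqxx _).
  exists i => // j jk; rewrite /Rgamma /=.
  suff : dist i z - w i <= dist j z - w j by lra.
  rewrite leNgt; apply/negP => ji; apply: nBz; exists j => // i' i'k.
  by have := imin i' i'k; rewrite /Rgamma /=; lra.
(* The cells of [k] and [m] under [w] lie in [A] and [B] respectively, and both meet [C]. *)
have CA : C `&` A !=set0.
  have [z [Cz zk]] := VR0 k; exists z; split=> //.
  exists k => [|j jk]; first exact: eqxx.
  have jk' : j != k by apply: contraTneq jk => ->; rewrite ltxx.
  by have := zk j jk'; rewrite /Rgamma /=; lra.
have CB : C `&` B !=set0.
  have [z [Cz zm]] := VR0 m; exists z; split=> //; exists m => // i ik.
  have im : i != m by apply: contraTneq mk => <-; rewrite /= (eqP ik) ltxx.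
  by have := zm i im; rewrite /Rgamma /=; lra.
exists (C `&` A `&` B); split.
- by apply: openI => //; exact: openI.
- exact: path_connected_overlap.
- by move=> z [[]].
move=> i; have [ik|ik] := eqVneq (dl i) (dl k); [right; split|left].
- move=> z zi j ji; have := zi j ji; have := kmax j; rewrite -ik /Rgamma /dl /=; lra.
- rewrite -subset0 => z [[_ [j jk zj]] zi].
  have ij : j != i by apply: contraTneq jk => ->; rewrite ik ltxx.
  by have := zi j ij; have := zj i (introT eqP ik); rewrite /Rgamma /=; lra.
- rewrite -subset0 => z [[[_ [i' i'k zi']] _] zi].
  have {}ik : dl i < dl k by rewrite lt_neqAle ik kmax.
  have i'i : i' != i by apply: contraTneq ik => <-; rewrite (eqP i'k) ltxx.
  have := zi i' i'i; have := zi' i ik; have := mmax i ik; move/eqP: i'k.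
  by rewrite /Rgamma /e /dl /=; lra.
Qed.
End Separation.

(* In dimension 0 every box has volume 1 (an empty product), so even the empty
   set, which needs infinitely many boxes, has infinite outer measure. *)
Lemma lebesgue_outer_dim0 {R : realType} (A : set 'rV[R]_0) :
  lebesgue_outer A = +oo%E.
Proof.
apply/eqP; rewrite eq_le leey/=; apply: le_ereal_inf_tmp => _ [a [b [_ ->]]].
rewrite leye_eq; apply/eqP/eqyP => M M0.
apply: le_trans (nneseries_lim_ge (Num.truncn M).+1 _); last first.
  by move=> k _ _; rewrite lee_fin obox_vol_ge0.
under eq_bigr do rewrite /obox_vol big_ord0.
rewrite sumEFin lee_fin sumr_const_nat subn0 ltW//.
by rewrite -[_ *+ _]/(_%:R) truncnS_gt.
Qed.

(** * Turning [mu] into a measure on the Caratheodory sigma-algebra *)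

Section MeasureOfEquivalent.
Context {R : realType} {d : nat}.
Local Notation T := (caratheodory_type (@lebesgue_outer R d.+1)).
Variable mu : set 'rV[R]_d.+1 -> \bar R.
Hypothesis mu_equiv : lebesgue_equivalent_measure mu.

(* [mu] is unconstrained, possibly negative, on non-measurable sets, whereas a
   library measure must be nonnegative on all sets. *)
Definition on_measurable (A : set T) : \bar R :=
  if `[< lebesgue_measurable A >] then mu A else 0%E.

Lemma on_measurableE (A : set T) : lebesgue_measurable A -> on_measurable A = mu A.
Proof. by rewrite /on_measurable => /asboolP ->. Qed.

Let on_measurable0 : on_measurable set0 = 0%E.
Proof.
by rewrite on_measurableE; [case: mu_equiv|exact: caratheodory_measurable_set0].
Qed.

Let on_measurable_ge0 A : (0 <= on_measurable A)%E.
Proof.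
by rewrite /on_measurable; case: asboolP => // mA; case: mu_equiv => _ ->.
Qed.

Let on_measurable_semi_sigma_additive : semi_sigma_additive on_measurable.
Proof.
move=> F mF tF mUF; rewrite on_measurableE//.
under eq_fun do under eq_bigr do rewrite (on_measurableE _ (mF _)).
by case: mu_equiv => _ _ + _; apply.
Qed.

HB.instance Definition _ := isMeasure.Build _ _ _ on_measurable
  on_measurable0 on_measurable_ge0 on_measurable_semi_sigma_additive.

(** Restricting to [C] turns the parts of [C] into plain cells; the total mass becomes [mu C], which
    is finite in the application. *)
Lemma exists_restricted_measure (C : set T) : lebesgue_measurable C ->
  exists nu : {measure set T -> \bar R},
    forall A, lebesgue_measurable A -> nu A = mu (C `&` A).
Proof.
move=> mC; exists (mrestr on_measurable mC) => A mA.
by rewrite setIC -on_measurableE//; exact: caratheodory_measurable_setI.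
Qed.

End MeasureOfEquivalent.

Theorem theorem1 (R : realType) (d n : nat) (mu : set 'rV[R]_d -> \bar R)
    (p : 'I_n -> 'rV[R]_d) (dist : 'I_n -> 'rV[R]_d -> R)
    (C : set 'rV[R]_d) (lam : 'I_n -> R) :
  (2 <= n)%N ->
  lebesgue_equivalent_measure mu ->
  injective p ->
  (forall i, continuous (dist i)) ->
  (forall i z, 0 <= dist i z) ->
  admissible mu dist ->
  bounded_set C -> open C ->
  (forall i, 0 < lam i) ->
  (\sum_(i < n) (lam i)%:E)%E = mu C ->
  (exists w : 'I_n -> R, forall i, mu (C `&` VR dist w i) = (lam i)%:E) /\
  (path_connected C ->
   forall w w' : 'I_n -> R,
     (forall i, mu (C `&` VR dist w i) = (lam i)%:E) ->
     (forall i, mu (C `&` VR dist w' i) = (lam i)%:E) ->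
     (exists c : R, forall i, w' i = w i + c) /\
     (forall i, C `&` VR dist w' i = C `&` VR dist w i)).
Proof.
case: d => [|d] in mu p dist C *.
  (* Dimension 0 is contradictory: the empty set is measurable and [mu]-null but has outer measure
     [+oo]. *)
  move=> _ [mu0 _ _ mu_null].
  have /mu_null[+ _] : lebesgue_measurable (@set0 'rV[R]_0).
    by move=> E; rewrite !lebesgue_outer_dim0.
  by move=> /(_ mu0); rewrite lebesgue_outer_dim0.
move=> n2 mu_equiv _ cdist _ adm bC oC lam0 lamE.
have i0 : 'I_n by exact: (Ordinal (ltnW n2)).
pose T := caratheodory_type (@lebesgue_outer R d.+1).
have openm (U : set T) : open (U : set 'rV[R]_d.+1) -> measurable U.
  by move=> oU; exact: open_lebesgue_measurable.
have [nu nuE'] := exists_restricted_measure mu mu_equiv C (openm C oC).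
have nuE (U : set 'rV[R]_d.+1) : open U -> nu U = mu (C `&` U).
  by move=> oU; apply: nuE'; exact: open_lebesgue_measurable.
have oR := open_Rgamma dist cdist; have oV := open_VR dist cdist.
pose f : 'I_n -> T -> R := dist.
have mbelow i j g : measurable (below f i j g) by exact: openm (oR i j g).
have mcell w i : measurable (VR dist w i : set T) by exact: openm (oV w i).
have nuT : nu setT = (\sum_(i < n) (lam i)%:E)%E.
  by rewrite lamE nuE ?setIT//; exact: openT.
have nufin : (nu setT < +oo)%E by rewrite nuT sumEFin ltry.
have nucont i j : i != j -> continuous (fun g => nu (below f i j g)).
  move=> ij; have [m [M [_ [+ _]]]] := adm i j ij C bC oC.
  suff -> : (fun g => nu (below f i j g)) =
      (fun g => mu (C `&` Rgamma dist i j g)) by [].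
  by apply/funext => g; rewrite (nuE _ (oR i j g)).
split.
  have [|//|//|w wP] := exists_cells nu f mbelow nufin nucont i0 lam.
  - move=> i j ij; have [m [M [_ [_ [_ [m0 _]]]]]] := adm i j ij C bC oC.
    exists m => g gm; rewrite (nuE _ (oR i j g)) m0//.
    by case: mu_equiv.
  by exists w => i; rewrite -wP -(nuE _ (oV w i)).
move=> pC w w' wP w'P.
suff [c w'E] : exists c, forall i, w' i = w i + c.
  split; first by exists c.
  move=> i; congr (_ `&` _); apply: eq_bigcapr => j _; congr Rgamma.
  by rewrite !w'E; lra.
apply: contrapT => ww'.
(* All cells of [w] meet [C] because [lam i > 0]. *)
have [i|G [oG G0 GC GP]] := separating_open dist cdist C w w' oC pC _ ww'.
  apply/set0P/eqP => VR0; have := wP i; rewrite VR0.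
  case: mu_equiv => -> _ _ _ [] /esym lami.
  by have := lam0 i; rewrite lami ltxx.
suff : nu G = 0%E.
  rewrite (nuE _ oG) setIidr// => muG.
  have := open_lebesgue_outer_gt0 G oG G0.
  case: mu_equiv => _ _ _ /(_ G (open_lebesgue_measurable G oG))[/(_ muG) ->].
  by rewrite ltxx.
apply: (null_of_cells nu f mbelow nufin nucont i0 w'); first exact: openm oG.
move=> i; have [GV|[VV GV]] := GP i; first by rewrite [X in nu X]GV measure0.
(* The cell of [i] grows from [w] to [w'] but keeps measure [lam i], so the difference, which
   contains this part of [G], is null. *)
apply: (@subset_measure0 _ _ _ nu _ (VR dist w' i `\` VR dist w i)).
- by apply: measurableI; [exact: openm oG|exact: mcell].
- by apply: measurableD; exact: mcell.
- move=> z [Gz zi]; split=> // zw.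
  by rewrite -[False]/(set0 z) -GV.
rewrite measureD; [|exact: mcell|exact: mcell|].
  rewrite setIidr//.
  rewrite -[LHS]/(nu (VR dist w' i) - nu (VR dist w i))%E.
  by rewrite !(nuE _ (oV _ i)) wP w'P subee.
rewrite -[ltLHS]/(nu (VR dist w' i)).
by rewrite (nuE _ (oV _ i)) w'P ltry.
Qed.
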